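(* Let $\mathbf{A}$ be a standard algebra and let $\mathcal G=\langle N,V,\{V_i\}_{i\in N},\{S_i\}_{i\in N},\{\varphi_i\}_{i\in N}\rangle$ be a finite logical $\mathbf A$-game which is expressible, i.e. for every $\mathcal G$-relevant element $a$ there is an $\mathcal L_{\mathbf A}$-formula $\bar a$ with $e(\bar a)=a$ for every $\mathbf A$-evaluation $e$. For each $\mathcal G$-relevant $a$ let $\chi_a(v)$ be a pseudo-characteristic formula for $a$ in $\mathbf A$ (one exists, e.g. $(v\to\bar a)\wedge(\bar a\to v)$). Write $\vec v_i=\langle v_i^1,\dots,v_i^{|V_i|}\rangle$, $\vec v=\langle \vec v_1,\dots,\vec v_n\rangle$, and define $$\gamma_{\mathcal G}(\vec v)=\bigwedge_{i\in N}\ \bigwedge_{\vec s_i\in S_i}\Bigl(\varphi_i(\vec v_1,\dots,\vec v_{i-1},\bar s_i^1,\dots,\bar s_i^{|V_i|},\vec v_{i+1},\dots,\vec v_n)\to\varphi_i(\vec v_1,\dots,\vec v_n)\Bigr).$$ Then $\mathcal G$ has a pure Nash equilibrium if and only if the formula $$\Bigl(\bigvee_{\vec s\in S}\ \bigwedge_{i\in N}\ \bigwedge_{j\le |V_i|}\chi_{s_i^j}(v_i^j)\Bigr)\wedge\gamma_{\mathcal G}(\vec v)$$ is $\mathbf A$-satisfiable. Moreover, if $\mathcal G$ is full, then $\mathcal G$ has a pure Nash equilibrium if and only if $\gamma_{\mathcal G}(\vec v)$ is $\mathbf A$-satisfiable.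
   Context: A standard algebra $\mathbf A$ in a propositional language $\mathcal L_{\mathbf A}$ (a set of connectives with arities containing at least binary $\wedge,\vee,\to$) consists of a set $A\subseteq[0,1]$ with $1\in A$ and, for each $n$-ary connective $\circ$, an operation $\circ^{\mathbf A}:A^n\to A$ (an element of $A$ if $n=0$), such that for all $x,y\in A$: $x\wedge^{\mathbf A}y=1$ iff $x=y=1$; $x\vee^{\mathbf A}y=1$ iff $x=1$ or $y=1$; $x\to^{\mathbf A}y=1$ iff $x\le y$. Formulas are built from countably many propositional variables. An $\mathbf A$-evaluation maps variables into $A$ and extends to all formulas by applying the operations; it satisfies $\varphi$ if $e(\varphi)=1$; $\varphi$ is $\mathbf A$-satisfiable if some evaluation satisfies it. $\varphi(\psi_1,\dots,\psi_k)$ denotes substitution of $\psi_j$ for the variables of $\varphi$, and $\varphi^{\mathbf A}(a_1,\dots,a_k)$ denotes the value $e(\varphi)$ for any $e$ mapping the variables to $a_1,\dots,a_k$. A pseudo-characteristic formula for $a\in A$ is a one-variable formula $\chi_a$ with $\chi_a^{\mathbf A}(x)=1$ iff $x=a$, for $x\in A$. A logical $\mathbf A$-game $\mathcal G=\langle N,V,\{V_i\},\{S_i\},\{\varphi_i\}\rangle$ consists of players $N=\{1,\dots,n\}$, a finite set $V$ of variables partitioned into $V_1,\dots,V_n$ with $V_i=\{v_i^1,\dots,v_i^{|V_i|}\}$ (player $i$ controls $V_i$), nonempty strategy sets $S_i\subseteq A^{V_i}$ (a strategy $\vec s_i$ is identified with the tuple $\langle s_i^1,\dots,s_i^{|V_i|}\rangle$,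 $s_i^j=\vec s_i(v_i^j)$), and $\mathcal L_{\mathbf A}$-formulas $\varphi_i$ over variables in $V$. A strategy profile $\vec s\in S=S_1\times\dots\times S_n$ is identified with the evaluation of $V$ sending $v_i^j$ to $s_i^j$, and the payoff of player $i$ at $\vec s$ is $\varphi_i^{\mathbf A}(\vec s)$. $\mathcal G$ is finite if every $S_i$ is finite and full if $S_i=A^{V_i}$ for all $i$. An element $a\in A$ is $\mathcal G$-relevant if $a=\vec s_i(v)$ for some $i\in N$, $v\in V_i$, $\vec s_i\in S_i$. A pure Nash equilibrium is a profile $\vec s^*\in S$ such that for every $i$ and every $\vec s_i\in S_i$, the payoff of $i$ at $\langle \vec s_i,\vec s^*_{-i}\rangle$ (profile $\vec s^*$ with $i$'s strategy replaced by $\vec s_i$) is $\le$ the payoff of $i$ at $\vec s^*$. *)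

(* Defs.v *)
(* Based on MathComp, with MathComp-Analysis for sets of reals. *)
From mathcomp Require Import all_boot all_order all_algebra finmap.
From mathcomp Require Import all_classical reals.

Set Implicit Arguments.
Unset Strict Implicit.
Unset Printing Implicit Defensive.

Import Order.TTheory GRing.Theory Num.Theory.
Local Open Scope classical_set_scope.
Local Open Scope ring_scope.

(** * Formulas *)

(* A propositional language is given by its connectives besides the three
   compulsory ones. *)
Record language := Language {
  extra : Type;
  extra_arity : extra -> nat }.

Inductive connective (L : language) : Type :=
  | Cand | Cor | Cimp
  | Cextra of extra L.
Arguments Cand {L}.
Arguments Cor {L}.
Arguments Cimp {L}.

Definition arity (L : language) (c : connective L) : nat :=
  match c with
  | Cand | Cor | Cimp => 2
  | Cextra d => extra_arity d
  end.

Inductive formula (L : language) : Type :=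
  | Var of nat
  | App (c : connective L) of ('I_(arity c) -> formula L).
Arguments Var {L}.
Arguments App {L}.

Definition pair2 (T : Type) (x y : T) (k : 'I_2) : T :=
  if k == ord0 then x else y.

Section Formulas.
Context {L : language}.
Implicit Types (phi psi : formula L).

Definition andf phi psi : formula L := App Cand (pair2 phi psi).
Definition orf phi psi : formula L := App Cor (pair2 phi psi).
Definition impf phi psi : formula L := App Cimp (pair2 phi psi).

Fixpoint occurs (x : nat) phi : Prop :=
  match phi with
  | Var y => y = x
  | App c args => exists k, occurs x (args k)
  end.

Fixpoint subst (sigma : nat -> formula L) phi : formula L :=
  match phi with
  | Var x => sigma x
  | App c args => App c (fun k => subst sigma (args k))
  end.

Definition one_variable phi : Prop :=
  exists p, forall x, occurs x phi -> x = p.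

(* phi(v), for a one-variable formula phi; all variables of phi become v. *)
Definition at_var phi (v : nat) : formula L := subst (fun=> Var v) phi.

(* Truth, the value of an empty conjunction: p -> p takes the value 1 in every
   standard algebra. *)
Definition topf : formula L := impf (Var 0%N) (Var 0%N).

Fixpoint bigandf (s : seq (formula L)) : formula L :=
  match s with
  | [::] => topf
  | [:: phi] => phi
  | phi :: s' => andf phi (bigandf s')
  end.

(* Falsity need not be definable, so the value at [::] is a dummy; below,
   disjunctions are only taken over the nonempty set of strategy profiles. *)
Fixpoint bigorf (s : seq (formula L)) : formula L :=
  match s with
  | [::] => Var 0%N
  | [:: phi] => phi
  | phi :: s' => orf phi (bigorf s')
  end.

End Formulas.

(** * Standard algebras *)

(* Elements of the algebra are points of the set type associated with
   [carrier]; [val] maps them to reals. *)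
Record standard_algebra (R : realType) (L : language) := StandardAlgebra {
  carrier :> set R;
  carrier_unit : carrier `<=` [set x | 0 <= x <= 1];
  carrier1 : carrier 1;
  op : forall c : connective L, ('I_(arity c) -> carrier) -> carrier;
  and_eq1 : forall x y : carrier,
    val (@op Cand (pair2 x y)) = 1 <-> val x = 1 /\ val y = 1;
  or_eq1 : forall x y : carrier,
    val (@op Cor (pair2 x y)) = 1 <-> val x = 1 \/ val y = 1;
  imp_eq1 : forall x y : carrier,
    val (@op Cimp (pair2 x y)) = 1 <-> val x <= val y }.

Section Semantics.
Context {R : realType} {L : language} (A : standard_algebra R L).

Definition one : A := exist _ 1 (mem_set (carrier1 A)).

Fixpoint eval (e : nat -> A) (phi : formula L) : A :=
  match phi with
  | Var x => e x
  | App c args => op (fun k => eval e (args k))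
  end.

Definition satisfiable (phi : formula L) : Prop :=
  exists e : nat -> A, eval e phi = one.

Definition expresses (phi : formula L) (a : A) : Prop :=
  forall e : nat -> A, eval e phi = a.

Definition pseudo_characteristic (chi : formula L) (a : A) : Prop :=
  one_variable chi /\ forall x : A, eval (fun=> x) chi = one <-> x = a.

End Semantics.

(** * Logical games *)

(* Player i controls the pairwise distinct variables [gvar i j], that is
   v_i^j, for j < nvars i; the variables of the game are all the [gvar i j],
   and injectivity of [gvar] in (i, j) says that the V_i are disjoint and that
   v_i^1, v_i^2, etc. enumerate V_i without repetition. *)
Record logical_game (R : realType) (L : language)
    (A : standard_algebra R L) := LogicalGame {
  players : nat;
  nvars : 'I_players -> nat;
  gvar : forall i : 'I_players, 'I_(nvars i) -> nat;
  gvar_inj : injective (fun p : {i & 'I_(nvars i)} => gvar (tagged p));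
  strategies : forall i : 'I_players, set ('I_(nvars i) -> A);
  strategies_neq0 : forall i, @strategies i !=set0;
  payoff_formula : 'I_players -> formula L;
  payoff_formula_vars : forall i x, occurs x (payoff_formula i) ->
    exists k (j : 'I_(nvars k)), x = gvar j }.
Arguments gvar {R L A} l [i] j.
Arguments strategies {R L A} l i _.

Section Games.
Context {R : realType} {L : language} {A : standard_algebra R L}.
Variable G : logical_game A.
Notation N := 'I_(players G).

Definition strategy (i : N) : Type := 'I_(nvars i) -> A.
Definition profile : Type := forall i : N, 'I_(nvars i) -> A.

Definition profiles : set profile := [set s | forall i, strategies G i (s i)].

Definition finite_game : Prop := forall i, finite_set (strategies G i).

Definition full_game : Prop := forall i, strategies G i = setT.

Definition relevant (a : A) : Prop :=
  exists (i : N) (j : 'I_(nvars i)) (s : strategy i),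
    strategies G i s /\ s j = a.

Definition expressible : Prop :=
  forall a, relevant a -> exists phi, expresses phi a.

(* The evaluation identified with a profile. Its value outside the variables
   of the game is irrelevant to payoffs. *)
Definition profile_eval (s : profile) (x : nat) : A :=
  if [pick p : {i : N & 'I_(nvars i)} | gvar G (tagged p) == x] is Some p
  then s (tag p) (tagged p) else one A.

Definition payoff (i : N) (s : profile) : A :=
  eval (profile_eval s) (payoff_formula i).

Definition pure_nash (s : profile) : Prop :=
  profiles s /\
  forall (i : N) (t : strategy i), strategies G i t ->
    val (payoff i (dfwith s i t)) <= val (payoff i s).

Definition has_pure_nash : Prop := exists s, pure_nash s.

(* Replaces v_i^j by the formula denoting t_j, for all j, and fixes the
   variables of the other players. *)
Definition deviation_subst (bar : A -> formula L) (i : N) (t : strategy i)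
    (x : nat) : formula L :=
  if [pick j : 'I_(nvars i) | gvar G j == x] is Some j
  then bar (t j) else Var x.

Definition gammaf (bar : A -> formula L) : formula L :=
  bigandf [seq
    bigandf [seq impf (subst (deviation_subst bar t) (payoff_formula i))
                      (payoff_formula i)
            | t <- fset_set (strategies G i)]
  | i <- enum N].

(* The inner conjunction ranges over all pairs (i, j), in a single list, so
   that players without variables contribute no conjunct. *)
Definition profile_formula (chi : A -> formula L) (s : profile) : formula L :=
  bigandf (flatten [seq
    [seq at_var (chi (s i j)) (gvar G j) | j <- enum 'I_(nvars i)]
  | i <- enum N]).

Definition strategy_formula (chi : A -> formula L) : formula L :=
  bigorf [seq profile_formula chi s | s <- fset_set profiles].

End Games.

(* Main.v *)
(* Evaluations e and profiles s correspond via s_i^j = e(v_i^j), up to values of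
   e off the variables of the game. Since barred elements denote constants,
   substituting them for the variables of player i amounts to a unilateral
   deviation; so, as an implication has value 1 iff its antecedent is at most
   its consequent, e satisfies gamma iff no player gains by deviating to a
   strategy in S_i.
   What remains is that the profile of e is admissible: the disjunction over
   all profiles says so, and in a full game it always is. *)
Require Import Defs.
From mathcomp Require Import all_boot all_order all_algebra finmap.
From mathcomp Require Import all_classical reals.

Set Implicit Arguments.
Unset Strict Implicit.
Unset Printing Implicit Defensive.

Import Order.TTheory.
Local Open Scope classical_set_scope.
Local Open Scope ring_scope.

Lemma mem_fset_setP (T : choiceType) (S : set T) x : finite_set S ->
  x \in fset_set S <-> S x.
Proof. by move=> finS; rewrite in_fset_set //; split=> [/set_mem|/mem_set]. Qed.

(** Each such [s] underlies a dependent finite function into the finite types [fset_set (S i)], and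
    there are finitely many of those. *)
Lemma finite_dprod (I : finType) (T : I -> choiceType)
    (S : forall i, set (T i)) :
  (forall i, finite_set (S i)) -> finite_set [set s | forall i, S i (s i)].
Proof.
move=> finS; pose F (i : I) : finType := fset_set (S i).
apply: (@sub_finite_set _ _
  (range (fun (f : {dffun forall i, F i}) i => val (f i)))).
  move=> s Ss.
  have sF i : s i \in fset_set (S i) by apply/mem_fset_setP.
  exists (finfun (fun i => [` sF i]%fset : F i)) => //.
  by apply: functional_extensionality_dep => i; rewrite ffunE.
exact: finite_image.
Qed.

Section Semantics.
Context {R : realType} {L : language} {A : standard_algebra R L}.
Implicit Types (phi psi : formula L) (e : nat -> A).

Lemma eq_oneE (x : A) : x = Defs.one A <-> val x = 1.
Proof. by split=> [->//|x1]; apply: val_inj. Qed.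

Lemma pair2_comp (T U : Type) (f : T -> U) (x y : T) :
  (fun k => f (pair2 x y k)) = pair2 (f x) (f y).
Proof. by apply/funext => k; rewrite /pair2; case: ifP. Qed.

Lemma eval_andf e phi psi :
  eval e (andf phi psi) = Defs.one A <->
  eval e phi = Defs.one A /\ eval e psi = Defs.one A.
Proof. by rewrite !eq_oneE -and_eq1 /= -pair2_comp. Qed.

Lemma eval_orf e phi psi :
  eval e (orf phi psi) = Defs.one A <->
  eval e phi = Defs.one A \/ eval e psi = Defs.one A.
Proof. by rewrite !eq_oneE -or_eq1 /= -pair2_comp. Qed.

Lemma eval_impf e phi psi :
  eval e (impf phi psi) = Defs.one A <-> val (eval e phi) <= val (eval e psi).
Proof. by rewrite eq_oneE -imp_eq1 /= -pair2_comp. Qed.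

Lemma eval_bigandf (T : eqType) e (f : T -> formula L) (s : seq T) :
  eval e (bigandf (map f s)) = Defs.one A <->
  forall x, x \in s -> eval e (f x) = Defs.one A.
Proof.
elim: s => [|x [|y s] IH].
(* The empty conjunction is [topf], whose two sides have equal values. *)
- by split=> // _; apply/eval_impf.
- by split=> [fx z|]; [rewrite inE => /eqP -> | apply; rewrite inE].
- have -> : bigandf (map f [:: x, y & s]) =
    andf (f x) (bigandf (map f (y :: s))) by [].
  rewrite eval_andf IH; split=> [[fx fs] z|fs].
    by rewrite in_cons => /orP[/eqP->//|/fs].
  by split=> [|z zs]; apply: fs; rewrite in_cons ?eqxx// zs orbT.
Qed.

Lemma eval_bigorf (T : eqType) e (f : T -> formula L) (s : seq T) :
  s != [::] ->
  eval e (bigorf (map f s)) = Defs.one A <->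
  exists2 x, x \in s & eval e (f x) = Defs.one A.
Proof.
elim: s => [//|x [|y s] IH] _.
- by split=> [fx|[z]]; [exists x; rewrite ?inE | rewrite inE => /eqP ->].
- have -> : bigorf (map f [:: x, y & s]) =
    orf (f x) (bigorf (map f (y :: s))) by [].
  rewrite eval_orf IH //; split=> [[fx|[z zs fz]]|[z]].
  + by exists x; rewrite ?inE ?eqxx.
  + by exists z; rewrite // in_cons zs orbT.
  + by rewrite in_cons => /orP[/eqP->|zs fz]; [left | right; exists z].
Qed.

Lemma eq_eval e1 e2 phi :
  (forall x, occurs x phi -> e1 x = e2 x) -> eval e1 phi = eval e2 phi.
Proof.
elim: phi => [x|c args IH] /= e12; first exact: e12.
by congr op; apply/funext => k; apply: IH => x xk; apply: e12; exists k.
Qed.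

Lemma eval_subst e (sigma : nat -> formula L) phi :
  eval e (subst sigma phi) = eval (fun x => eval e (sigma x)) phi.
Proof.
by elim: phi => [//|c args IH] /=; congr op; apply/funext => k; apply: IH.
Qed.

Lemma occurs_at_var x phi v : occurs x (at_var phi v) -> x = v.
Proof. by elim: phi => [y|c args IH] /= => [->//|[k]]; exact: IH. Qed.

Lemma eval_at_var e phi (v : nat) :
  eval e (at_var phi v) = eval (fun=> e v) phi.
Proof. exact: eval_subst. Qed.

(** Renaming every variable of [phi] to [v] leaves a one-variable formula and, [phi] being constant,
    keeps its value [a]; the two implications then give x <= a and a <= x. *)
Lemma expresses_pseudo_characteristic phi (a : A) v : expresses phi a ->
  pseudo_characteristic
    (andf (impf (Var v) (at_var phi v)) (impf (at_var phi v) (Var v))) a.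
Proof.
move=> phia; split=> [|x].
  exists v => x /= [k]; rewrite /pair2; case: ifP => _ /= [l];
    rewrite /pair2; case: ifP => _ /=;
    first [by move=> -> | exact: occurs_at_var].
rewrite eval_andf !eval_impf eval_at_var phia /=; split=> [[xa ax]|->//].
by apply: val_inj; apply/eqP; rewrite eq_le xa ax.
Qed.

End Semantics.

Section Games.
Context {R : realType} {L : language} {A : standard_algebra R L}.
Variable G : logical_game A.
Implicit Types (e : nat -> A) (s : profile G).

Definition profile_of e : profile G := fun i j => e (gvar G j).

Lemma profile_eval_gvar s i (j : 'I_(nvars i)) :
  profile_eval s (gvar G j) = s i j.
Proof.
rewrite /profile_eval; case: pickP => [p /eqP pj|/(_ (Tagged _ j))].
  have -> : p = Tagged (fun i => 'I_(nvars i)) j by apply: (@gvar_inj _ _ _ G).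
  by [].
by rewrite eqxx.
Qed.

(** The composite in the other order resets an evaluation to 1 off the variables of the game. *)
Lemma profile_evalK : cancel (@profile_eval _ _ _ G) profile_of.
Proof.
move=> s; apply: functional_extensionality_dep => i; apply/funext => j.
exact: profile_eval_gvar.
Qed.

(** Payoff formulas contain only game variables. This is applied to evaluations of any origin, in
    particular to those produced by a substitution. *)
Lemma payoffE e s (i : 'I_(players G)) :
  (forall k (j : 'I_(nvars k)), e (gvar G j) = s k j) ->
  payoff i s = eval e (payoff_formula i).
Proof.
move=> es; apply: eq_eval => x /payoff_formula_vars[k [j ->]].
by rewrite profile_eval_gvar es.
Qed.

Section Gamma.
Variable bar : A -> formula L.
Hypothesis barP : forall a : A, relevant G a -> expresses (bar a) a.

(** Substitution is absorbed into the evaluation, which then takes the value t_j at v_i^j and agrees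
    with [e] on the variables of the other players. *)
Lemma eval_deviation e i (t : strategy i) : strategies G i t ->
  eval e (subst (deviation_subst bar t) (payoff_formula i)) =
  payoff i (dfwith (profile_of e) i t).
Proof.
move=> it; rewrite eval_subst; apply/esym/payoffE => k j.
rewrite /deviation_subst; case: pickP => [l /eqP lj|ni].
  (* Equal variables have equal owners; once [k] is identified with [i], the indices [l] and [j]
     have the same type and coincide. *)
  have /eqP := @gvar_inj _ _ _ G (existT _ i l) (existT _ k j) lj.
  rewrite -tag_eqE /tag_eq /= => /andP[/eqP ik].
  case: _ / ik j lj => j lj; rewrite tagged_asE => /eqP <-.
  by rewrite dfwithin barP //; exists i, l, t.
(* If [k] were [i], then [pick] would have found [j]. *)
rewrite dfwithout //; apply/eqP => ik; case: _ / ik j ni => j /(_ j).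
by rewrite eqxx.
Qed.

Lemma eval_gammaf e : finite_game G ->
  eval e (gammaf G bar) = Defs.one A <->
  forall i (t : strategy i), strategies G i t ->
    val (payoff i (dfwith (profile_of e) i t)) <=
    val (payoff i (profile_of e)).
Proof.
move=> finG; rewrite eval_bigandf.
have gammaE i (t : strategy i) : strategies G i t ->
    eval e (impf (subst (deviation_subst bar t) (payoff_formula i))
              (payoff_formula i)) = Defs.one A <->
    val (payoff i (dfwith (profile_of e) i t)) <=
    val (payoff i (profile_of e)).
  by move=> it; rewrite eval_impf eval_deviation // (@payoffE e (profile_of e)).
split=> [ge i t it|ge i _].
  apply/(gammaE _ _ it).
  have /eval_bigandf := ge i (etrans (mem_enum _ i) isT); apply.
  exact/(mem_fset_setP _ (finG i)).
apply/eval_bigandf => t /(mem_fset_setP _ (finG i)) it.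
exact/(gammaE _ _ it)/ge.
Qed.

(** Admissibility is the one clause of an equilibrium that [gammaf] does not express. *)
Lemma pure_nash_profile_of e : finite_game G -> profiles (profile_of e) ->
  pure_nash (profile_of e) <-> eval e (gammaf G bar) = Defs.one A.
Proof. by move=> finG se; rewrite eval_gammaf //; split=> [[]|]. Qed.

End Gamma.

Section Strategy.
Variable chi : A -> formula L.
Hypothesis chiP : forall a : A, relevant G a -> pseudo_characteristic (chi a) a.

Lemma eval_profile_formula e s : profiles s ->
  eval e (profile_formula chi s) = Defs.one A <-> profile_of e = s.
Proof.
move=> ss; rewrite /profile_formula.
(* Indexing by pairs (i, j) turns the flattened conjunction into a single [map], to which
   [eval_bigandf] applies. *)
pose T := {i : 'I_(players G) & 'I_(nvars i)}.
pose f (p : T) : formula L :=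
  at_var (chi (s (tag p) (tagged p))) (gvar G (tagged p)).
have -> : flatten [seq [seq at_var (chi (s i j)) (gvar G j)
                       | j <- enum 'I_(nvars i)] | i <- enum 'I_(players G)] =
    map f [seq Tagged (fun i => 'I_(nvars i)) j
          | i <- enum 'I_(players G), j <- enum 'I_(nvars i)].
  by rewrite map_allpairs.
have chiE i j : eval e (f (Tagged _ j)) = Defs.one A <-> e (gvar G j) = s i j.
  rewrite /f eval_at_var /=; apply: (chiP _).2.
  by exists i, j, (s i).
rewrite eval_bigandf; split=> [fe|es [i j] _].
  apply: functional_extensionality_dep => i; apply/funext => j.
  by apply/chiE/fe/allpairsPdep; exists i, j; rewrite !mem_enum.
by apply/chiE; rewrite -es.
Qed.

Lemma eval_strategy_formula e : finite_game G ->
  eval e (strategy_formula G chi) = Defs.one A <-> profiles (profile_of e).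
Proof.
move=> finG; have finS : finite_set (@profiles _ _ _ G).
  exact: (@finite_dprod _ (fun i => 'I_(nvars i) -> A) (strategies G)).
(* Choosing a strategy for each player gives a profile, so the disjunction is not the dummy empty
   one. *)
have [s0 ss0] : @profiles _ _ _ G !=set0.
  exists (fun i => projT1 (cid (strategies_neq0 i))) => i.
  exact: projT2 (cid _).
rewrite eval_bigorf.
  split=> [[s]|se].
    by move=> /(mem_fset_setP _ finS) ss /eval_profile_formula ->.
  (* The true disjunct is that of the profile of [e] itself. *)
  exists (profile_of e); last exact/eval_profile_formula.
  exact/(mem_fset_setP _ finS).
apply/eqP => S0; have := (mem_fset_setP s0 finS).2 ss0.
by rewrite -[_ \in _]/(s0 \in enum_fset _) S0.
Qed.

End Strategy.
End Games.

Theorem theorem2 (R : realType) (L : language) (A : standard_algebra R L)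
    (G : logical_game A)
    (finG : finite_game G) (exprG : expressible G)
    (bar : A -> formula L)
    (barP : forall a : A, relevant G a -> expresses (bar a) a) :
  (forall (a : A) (v : nat), relevant G a ->
     pseudo_characteristic
       (andf (impf (Var v) (at_var (bar a) v))
             (impf (at_var (bar a) v) (Var v))) a) /\
  (forall chi : A -> formula L,
     (forall a : A, relevant G a -> pseudo_characteristic (chi a) a) ->
     (has_pure_nash G <->
      satisfiable A (andf (strategy_formula G chi) (gammaf G bar))) /\
     (full_game G ->
      (has_pure_nash G <-> satisfiable A (gammaf G bar)))).
Proof.
have gammaP e := @pure_nash_profile_of _ _ _ _ _ barP e finG.
split=> [a v /barP|chi chiP]; first exact: expresses_pseudo_characteristic.
(* The witness for both satisfiability claims is [profile_eval s], whose profile is [s] again. *)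
have nash_satisfied (s : profile G) : pure_nash s ->
    profiles (profile_of (profile_eval s) : profile G) /\
    eval (profile_eval s) (gammaf G bar) = Defs.one A.
  move=> ns; have [ss _] := ns; split; first by rewrite profile_evalK.
  by apply/gammaP; rewrite profile_evalK.
have strategyP e := @eval_strategy_formula _ _ _ _ _ chiP e finG.
split.
  split=> [[s /nash_satisfied[ss gs]]|[e /eval_andf[]]].
    exists (profile_eval s); apply/eval_andf; split=> //.
    exact/strategyP.
  move=> /strategyP se ge.
  by exists (profile_of e); apply/gammaP.
move=> fullG; split=> [[s /nash_satisfied[_ gs]]|[e ge]].
  by exists (profile_eval s).
by exists (profile_of e); apply/gammaP => // i; rewrite fullG.
Qed.
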